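(* Let $\mathbb{F}$ be a field, let $A_1,\dots,A_m\subset\mathbb{F}$ be finite non-empty subsets with $|A_i|=d_i$ and $d_1\le\dots\le d_m$, let $\mathcal{A}=A_1\times\cdots\times A_m\subset\mathbb{F}^m$, and let $d$ be an integer with $1\le d\le k:=\sum_{i=1}^m(d_i-1)$. Let $r$ be a positive integer with $r\le\dim_{\mathbb{F}} S_{\le d}(\mathcal{A})$. Then $$\max |Z(f_1,\dots,f_r)\cap\mathcal{A}|=\sum_{i=1}^m a_{r,i}\prod_{j=i+1}^m d_j,$$ where the maximum is taken over all $\mathbb{F}$-linearly independent $f_1,\dots,f_r\in S_{\le d}(\mathcal{A})$, and where $(a_{r,1},\dots,a_{r,m})$ is the $r$-th element of $F_{\le d}$ in descending lexicographic order.
   Context: $S_{\le d}(\mathcal{A})$ is the $\mathbb{F}$-vector space of polynomials $f\in\mathbb{F}[x_1,\dots,x_m]$ of total degree at most $d$ with $\deg_{x_i}f<d_i$ for all $i=1,\dots,m$. $Z(f_1,\dots,f_r)$ is the set of common zeros of $f_1,\dots,f_r$ in $\mathbb{F}^m$. $F=\{0,\dots,d_1-1\}\times\cdots\times\{0,\dots,d_m-1\}$ and $F_{\le d}=\{(i_1,\dots,i_m)\in F: i_1+\cdots+i_m\le d\}$. Lexicographic order on $F$: $a<_{lex}b$ iff the first nonzero coordinate of $b-a$ is positive; ''the $r$-th element in descending lexicographic order'' means the $r$-th largest. (Note $|F_{\le d}|=\dim S_{\le d}(\mathcal{A})$.) An empty product equals $1$. *)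

(* Defs.v *)
From HB Require Import structures.
From mathcomp Require Import all_boot all_order all_algebra.
From mathcomp Require Import finmap.
From mathcomp Require Import mpoly.

Set Implicit Arguments.
Unset Strict Implicit.
Unset Printing Implicit Defensive.

Import GRing.Theory.
Local Open Scope ring_scope.

(* Exponent in the i-th variable, as a monomial measure: mmeasure (mexp i) f
   is 1 + deg_{x_i} f (and 0 for f = 0), just as msize f is 1 + deg f. *)
Definition mexp (m : nat) (i : 'I_m) (a : 'X_{1..m}) : nat := a i.

Lemma mexp0 m (i : 'I_m) : mexp i 0%MM = 0%N.
Proof. exact: mnm0E. Qed.

Lemma mexpD m (i : 'I_m) : {morph mexp i : a b / (a + b)%MM >-> (a + b)%N}.
Proof. by move=> a b; exact: mnmDE. Qed.

HB.instance Definition _ m (i : 'I_m) :=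
  isMeasure.Build m (mexp i) (mexp0 i) (mexpD i).

Section ExponentBox.
Variables (m : nat) (n : 'I_m -> nat).

(* The set F_{<= d}, for the box F = prod_i {0, ..., n_i - 1}, listed without
   repetition. *)
Definition Fle (d : nat) : seq 'X_{1..m} :=
  [seq bmnm a | a : 'X_{1..m < d.+1}
     <- [seq a : 'X_{1..m < d.+1} <- enum {: 'X_{1..m < d.+1}}
        | [forall i, (bmnm a i < n i)%N]]].

Lemma mem_Fle d (a : 'X_{1..m}) :
  (a \in Fle d) = (mdeg a <= d)%N && [forall i, (a i < n i)%N].
Proof.
apply/mapP/andP => [[b]|[ad an]].
  by rewrite mem_filter => /andP[bn _] ->; split=> //; have := bmdeg b.
by exists (BMultinom (ad : (mdeg a < d.+1)%N)); rewrite // mem_filter mem_enum an.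
Qed.

Lemma Fle_uniq d : uniq (Fle d).
Proof.
rewrite map_inj_uniq => [|a b ab]; first exact: filter_uniq (enum_uniq _).
by apply/eqP; rewrite bmeqP; apply/eqP.
Qed.

End ExponentBox.

(* The order must not be confused with the canonical order on 'X_{1..m},
   which compares total degrees first. *)
Definition lexlt (m : nat) (a b : 'X_{1..m}) : bool :=
  [exists i : 'I_m, (a i < b i)%N && [forall j : 'I_m, (j < i)%N ==> (a j == b j)]].

Definition lexge (m : nat) (a b : 'X_{1..m}) : bool := (a == b) || lexlt b a.

Lemma lexltP m (a b : 'X_{1..m}) :
  reflect (exists2 i : 'I_m, (a i < b i)%N & forall j : 'I_m, (j < i)%N -> a j = b j)
          (lexlt a b).
Proof.
apply: (iffP existsP) => [[i /andP[ab /forallP e]]|[i ab e]]; exists i => //.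
  by move=> j ji; apply/eqP; apply: (implyP (e j)).
by rewrite ab; apply/forallP => j; apply/implyP => /e ->.
Qed.

Lemma lexge_total m : total (@lexge m).
Proof.
move=> a b; rewrite /lexge; case: eqVneq => //= ab.
have [i0 i0P] : exists i, a i != b i.
  by apply/existsP; apply: contraR ab => /existsPn e; apply/eqP/mnmP => i;
    apply/eqP; rewrite -[_ == _]negbK e.
case: (@arg_minnP _ i0 (fun i => a i != b i) val i0P) => i iP imin.
have e (j : 'I_m) : (j < i)%N -> a j = b j.
  by move=> ji; apply/eqP; apply: contraLR ji => /imin; rewrite -leqNgt.
case: (ltngtP (a i) (b i)) => [lt|gt|/eqP eq]; last by rewrite eq in iP.
- by apply/orP; right; apply/lexltP; exists i.
- by apply/orP; left; apply/lexltP; exists i => // j /e.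
Qed.

Lemma lexge_trans m : transitive (@lexge m).
Proof.
move=> b a c /predU1P[->//|/lexltP[i lti ei]] /predU1P[<-|/lexltP[j ltj ej]].
  by apply/orP; right; apply/lexltP; exists i.
apply/orP; right; apply/lexltP; case: (ltngtP i j) => [ij|ji|/val_inj ij].
- by exists i => [|k ki]; [rewrite ej | rewrite ej ?ei // (ltn_trans ki)].
- by exists j => [|k kj]; [rewrite -ei | rewrite ej ?ei // (ltn_trans kj)].
- by exists i => [|k ki]; [rewrite ij in lti *; apply: ltn_trans lti | rewrite ej ?ei // -ij].
Qed.

Definition Fle_desc (m : nat) (n : 'I_m -> nat) (d : nat) : seq 'X_{1..m} :=
  sort (@lexge m) (Fle n d).

Section ReducedPolynomials.
Variables (F : fieldType) (m : nat) (A : 'I_m -> {fset F}) (d : nat).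

Definition Sle_pred : {pred {mpoly F[m]}} :=
  [pred f | (msize f <= d.+1)%N
          & [forall i, (mmeasure (mexp i) f <= #|` A i|)%N]].

Record Sle : predArgType :=
  MkSle { mpoly_of_Sle :> {mpoly F[m]}; _ : mpoly_of_Sle \in Sle_pred }.

HB.instance Definition _ := [isSub for mpoly_of_Sle].
HB.instance Definition _ := [Choice of Sle by <:].

Lemma Sle_predP (f : {mpoly F[m]}) :
  reflect {subset msupp f <= Fle (fun i => #|` A i|) d} (f \in Sle_pred).
Proof.
rewrite inE; apply: (iffP andP) => [[fd /forallP fA] a af|sub].
  rewrite mem_Fle -ltnS (leq_trans (msize_mdeg_lt af) fd).
  by apply/forallP => i; apply: leq_trans (fA i); exact: (mmeasure_mnm_lt (mexp i)).
split; last apply/forallP => i; rewrite mmeasureE; apply/bigmax_leqP_seq => a /sub;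
  by rewrite mem_Fle => /andP[ad /forallP aA] _; rewrite ?ltnS ?ad //; apply: aA.
Qed.

Lemma Sle_submod_closed : submod_closed Sle_pred.
Proof.
split=> [|c f g /Sle_predP fS /Sle_predP gS].
  by apply/Sle_predP => a; rewrite msupp0.
apply/Sle_predP => a /msuppD_le; rewrite mem_cat => /orP[/msuppZ_le|].
  exact: fS.
exact: gS.
Qed.

HB.instance Definition _ :=
  GRing.isSubmodClosed.Build F {mpoly F[m]} Sle_pred Sle_submod_closed.
HB.instance Definition _ := [SubChoice_isSubLmodule of Sle by <:].

Lemma Sle_vecaxiom : vector_axiom (size (Fle (fun i => #|` A i|) d)) Sle.
Proof.
set s := Fle _ d.
exists (fun f : Sle => \row_(i < size s) (f : {mpoly F[m]})@_(nth 0%MM s i)).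
  by move=> c f g; apply/rowP => i; rewrite !mxE /= mcoeffD mcoeffZ.
pose g (r : 'rV[F]_(size s)) : {mpoly F[m]} :=
  \sum_(i < size s) r 0 i *: 'X_[nth 0%MM s i].
have gE r (i : 'I_(size s)) : (g r)@_(nth 0%MM s i) = r 0 i.
  rewrite raddf_sum (bigD1 i) //= mcoeffZ mcoeffX eqxx mulr1 big1 ?addr0 // => j ji.
  rewrite mcoeffZ mcoeffX nth_uniq ?Fle_uniq // (inj_eq val_inj).
  by rewrite (negbTE ji) mulr0.
have gS r : g r \in Sle_pred.
  apply: rpred_sum => i _; apply: rpredZ; apply/Sle_predP => a.
  by rewrite msuppX inE => /eqP ->; rewrite mem_nth.
exists (fun r => MkSle (gS r)) => [f|r]; last first.
  by apply/rowP => i; rewrite mxE gE.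
apply/val_inj/mpolyP => a /=; case: (boolP (a \in s)) => [as_|aNs].
  have ai : (index a s < size s)%N by rewrite index_mem.
  by rewrite -[a](nth_index 0%MM as_) (gE _ (Ordinal ai)) mxE.
by rewrite !memN_msupp_eq0 //; apply: contra aNs; apply: Sle_predP;
  [exact: (valP f) | exact: gS].
Qed.

HB.instance Definition _ := Lmodule_hasFinDim.Build F Sle Sle_vecaxiom.

Lemma dim_Sle : \dim {: Sle} = size (Fle (fun i => #|` A i|) d).
Proof. by rewrite dimvf. Qed.

End ReducedPolynomials.

(* The product A_1 x ... x A_m and its inclusion in F^m. *)
Definition grid (F : fieldType) (m : nat) (A : 'I_m -> {fset F}) : finType :=
  {dffun forall i : 'I_m, A i}.

Definition grid_pt (F : fieldType) (m : nat) (A : 'I_m -> {fset F})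
  (x : grid A) : 'I_m -> F := fun i => val (x i).

Definition common_zeros (F : fieldType) (m r : nat) (f : 'I_r -> {mpoly F[m]}) :
  {pred 'I_m -> F} := [pred x : 'I_m -> F | [forall k, (f k).@[x] == 0]].

(* Main.v *)
Require Import Defs.
From mathcomp Require Import all_boot all_order all_algebra.
From mathcomp Require Import finmap.
From mathcomp Require Import mpoly.
From mathcomp Require Import zify.

Set Implicit Arguments.
Unset Strict Implicit.
Unset Printing Implicit Defensive.

(** Write [n_i = #|A_i|], [box n] for the exponents below [n], and order the box
    lexicographically; [rank n p] counts the points of the box before [p].

    Upper bound.  The span of [r] linearly independent polynomials contains
    nonzero polynomials with [r] distinct leading monomials for a degree order
    ([free_leads]); these are exponents in the box of degree at most [d], and the
    polynomials still vanish on the common zeros [Z].  Let [D] be the footprint,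
    the set of points of the box above none of these [r] exponents.  On [Z] every
    monomial reduces to monomials of [D], while all functions on the finite set
    [Z] are polynomial; hence [#|Z| <= #|D|] ([footprint_bound]).  So it suffices
    to bound a downset [D] that misses at least [r] points of degree at most [d].

    This is a combinatorial problem: among downsets of given size, the initial
    segment of the lexicographic order has the fewest points of degree at most [d]
    ([low_segP]).  Since the segment of size [rank n a + 1], with [a] the [r]-th
    largest exponent of degree at most [d], misses only [r - 1] points of low
    degree, [#|D| <= rank n a].  Grouping the points before [a] by the first
    coordinate in which they differ from [a] gives the closed formula for
    [rank n a] ([rankE]).

    [low_segP] is proved by induction on the dimension.  In dimension 2 the sizes
    of the levels (the antidiagonals) of a downset cross those of the segment at
    most once ([low_down_planar]); this uses that the first side is the shorter one.
    In dimension at least 3, replacing every slice orthogonal to the first, or to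
    the last, direction by a segment of the same size does not increase the number
    of low points, by induction.  If neither operation changes [D] and [D] is not a
    segment, its first gap [x] and its last point [y] are so constrained that
    [deg y <= deg x] ([compressed_gap_deg]), and [y] can be moved to [x].  Each of
    these moves lowers the sum of the ranks, so the process stops, at the segment.

    Lower bound.  Enumerate each [A_i] and identify the grid with the box.  The
    product over [i] of the linear factors vanishing at the first [b_i] elements
    of [A_i] is nonzero exactly at the points above [b].  Taking for [b] the first
    [r] exponents, the common zeros are the points above none of them, which are
    the points before the [r]-th one ([desc_dominates]). *)

(** * Points of a box and the lexicographic order *)

(** Coordinates are bounded by an auxiliary [K], so that points form a finite type
    which does not depend on the sides of the box; slicing a box then stays
    within the same family of types. *)
Notation pt K m := {ffun 'I_m -> 'I_K.+1}.

Lemma card_ord_lt N c : c <= N -> #|[pred k : 'I_N | k < c]| = c.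
Proof. by move=> cN; rewrite -sum1_card -(big_ord_widen _ (fun=> 1)) // sum1_card card_ord. Qed.

Section Lex.
Variables K m : nat.
Implicit Types (p q x y : pt K m) (n : 'I_m -> nat) (D S : {set pt K m}).

Definition expo p : 'X_{1..m} := [multinom (p i : nat) | i < m].

Definition lex p q := lexlt (expo p) (expo q).

Definition deg p := \sum_i p i.

Definition low d : {set pt K m} := [set p | deg p <= d].

Definition box n : {set pt K m} := [set p : pt K m | [forall i, p i < n i]].

Definition down n D :=
  D \subset box n /\ forall p q, p \in D -> (forall i, q i <= p i) -> q \in D.

Definition initial n D :=
  D \subset box n /\ forall p q, p \in D -> q \in box n -> lex q p -> q \in D.

Definition rank n p := #|[set q in box n | lex q p]|.

Definition seg n N : {set pt K m} := [set p in box n | rank n p < N].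

Lemma in_seg n N p : (p \in seg n N) = (p \in box n) && (rank n p < N).
Proof. exact: in_set. Qed.

Lemma boxP n p : reflect (forall i, p i < n i) (p \in box n).
Proof. by rewrite inE; exact: forallP. Qed.

Lemma ptP p q : (forall i, p i = q i :> nat) -> p = q.
Proof. by move=> e; apply/ffunP => i; apply/val_inj/e. Qed.

Lemma lexP p q :
  reflect (exists2 i, p i < q i & forall j : 'I_m, j < i -> p j = q j) (lex p q).
Proof.
apply: (iffP (lexltP _ _)) => -[i]; rewrite ?mnmE => lti e; exists i; rewrite ?mnmE //.
- by move=> j /e; rewrite !mnmE => /val_inj.
- by move=> j /e; rewrite !mnmE => ->.
Qed.

Lemma lexxx p : lex p p = false.
Proof. by apply/lexP => -[i]; rewrite ltnn. Qed.

Lemma lex_trans p q x : lex p q -> lex q x -> lex p x.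
Proof.
move=> /lexP[i li ei] /lexP[j lj ej]; apply/lexP.
case: (ltngtP i j) => [ij|ji|/val_inj ij].
- by exists i => [|k ki]; [rewrite -ej | rewrite ei // ej // (ltn_trans ki)].
- by exists j => [|k kj]; [rewrite ei | rewrite ei ?ej // (ltn_trans kj)].
- by exists i => [|k ki]; [rewrite -ij in lj; exact: ltn_trans lj | rewrite ei // ej // -ij].
Qed.

Lemma lex_total p q : p != q -> lex p q || lex q p.
Proof.
have expo_inj : injective expo.
  by move=> a b /mnmP e; apply: ptP => i; have := e i; rewrite !mnmE.
rewrite -(inj_eq expo_inj) => pq.
by have := lexge_total (expo p) (expo q); rewrite /lexge [expo q == _]eq_sym (negbTE pq) orbC.
Qed.

Lemma lex_asym p q : lex p q -> lex q p = false.
Proof. by move=> pq; case E: (lex q p) => //; have := lex_trans pq E; rewrite lexxx. Qed.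

Lemma lexNge p q : ~~ lex p q -> q = p \/ lex q p.
Proof. by have [->|/lex_total/orP[->|->]] := eqVneq p q; [left| |right]. Qed.

Lemma le_lex p q : (forall i, q i <= p i) -> q = p \/ lex q p.
Proof.
move=> le; apply: lexNge; apply/negP => /lexP[i lti _].
by have := le i; rewrite leqNgt lti.
Qed.

Lemma rank_mono n p q : p \in box n -> lex p q -> rank n p < rank n q.
Proof.
move=> pb pq; apply: proper_card; apply/properP; split.
  by apply/subsetP => x; rewrite !inE => /andP[-> xp]; exact: lex_trans pq.
by exists p; rewrite inE ?lexxx ?andbF // pb.
Qed.

Lemma rank_le_lex n p q : p \in box n -> q \in box n ->
  (rank n p < rank n q) = lex p q.
Proof.
move=> pb qb; apply/idP/idP => [|/rank_mono->//].
apply: contraLR => /lexNge[->|/rank_mono h]; first by rewrite ltnn.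
by rewrite -leqNgt ltnW ?h.
Qed.

Lemma rank_inj n : {in box n &, injective (rank n)}.
Proof.
move=> p q pb qb e; apply/eqP; apply: contraT => /lex_total.
by rewrite -!(@rank_le_lex n) // e ltnn.
Qed.

Lemma rank_lt n p : p \in box n -> rank n p < #|box n|.
Proof.
move=> pb; apply: proper_card; apply/properP; split.
  by apply/subsetP => x; rewrite !inE => /andP[].
by exists p => //; rewrite inE lexxx andbF.
Qed.

(** The injection [rank n] of the box into [{0, ..., #|box n| - 1}] is onto by
    cardinality, so exactly [N] points have rank below [N]. *)
Lemma card_seg n N : N <= #|box n| -> #|seg n N| = N.
Proof.
move=> leN; case: N => [|N'] in leN *.
  by apply: eq_card0 => p; rewrite !inE ltn0 andbF.
move eN: N'.+1 leN => N leN.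
pose B := #|box n|.
have B0 : 0 < B by rewrite /B; apply: leq_trans leN; rewrite -eN.
pose f (p : pt K m) : 'I_B.-1.+1 := inord (rank n p).
have fE p : p \in box n -> f p = rank n p :> nat.
  by move=> pb; rewrite inordK // prednK // rank_lt.
have finj : {in box n &, injective f}.
  by move=> p q pb qb /(congr1 val) /=; rewrite !fE //; exact: rank_inj.
have fT : f @: box n = setT.
  by apply/eqP; rewrite eqEcard subsetT card_in_imset // cardsT card_ord prednK /=.
have -> : #|seg n N| = #|f @: seg n N|.
  rewrite card_in_imset // => p q; rewrite !inE => /andP[pb _] /andP[qb _].
  by apply: finj; rewrite inE.
have -> : f @: seg n N = [set i : 'I_B.-1.+1 | i < N].
  apply/setP => i; rewrite !inE; apply/imsetP/idP => [[p]|iN].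
    rewrite inE => /andP[pb pN] ->; by rewrite fE.
  have : i \in f @: box n by rewrite fT.
  case/imsetP => p pb ei; exists p => //.
  by rewrite inE pb -fE // -ei.
by rewrite cardsE card_ord_lt // prednK.
Qed.
End Lex.
Arguments box {K m} n.
Arguments seg {K m} n N.
Arguments low {K m} d.

(** * Initial segments *)

Section Segments.
Variables (K m : nat) (n : 'I_m -> nat).
Implicit Types (p q x y : pt K m) (D S : {set pt K m}).

Lemma seg_initial N : initial n (seg n N : {set pt K m}).
Proof.
split=> [|p q]; first by apply/subsetP => p; rewrite in_seg => /andP[].
rewrite !in_seg => /andP[pb pN] qb qp.
by rewrite qb (leq_trans _ pN) // ltnS ltnW // rank_mono.
Qed.

Lemma initial_down S : initial n S -> down n S.
Proof.
case=> Sb S_ini; split=> // p q pS le; have [->//|qp] := le_lex le.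
apply: (S_ini p) => //; apply/boxP => i; apply: leq_ltn_trans (le i) _.
exact: (boxP _ _ (subsetP Sb _ pS)).
Qed.

Lemma initial_seg S : initial n S -> S = seg n #|S|.
Proof.
case=> Sb S_ini; apply/eqP; rewrite eqEcard card_seg ?subset_leq_card ?leqnn ?andbT //.
apply/subsetP => p pS; have pb := subsetP Sb _ pS.
rewrite in_seg pb; apply: proper_card; apply/properP; split.
  by apply/subsetP => q; rewrite inE => /andP[]; exact: S_ini.
by exists p; rewrite // inE lexxx andbF.
Qed.

Lemma seg_sub N N' : N <= N' -> seg n N \subset (seg n N' : {set pt K m}).
Proof.
move=> le; apply/subsetP => p; rewrite !in_seg => /andP[-> /leq_trans]; exact.
Qed.

Lemma not_initialP D : D \subset box n -> D != seg n #|D| ->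
  exists p q, [/\ p \in D, q \in box n, q \notin D & lex q p].
Proof.
move=> Db DN; case: (boolP [forall p in D, forall q in box n, lex q p ==> (q \in D)]).
  move=> /forall_inP h; case/eqP: DN; apply: initial_seg; split=> // p q pD qb.
  by apply/implyP; move/forall_inP: (h p pD) => /(_ q qb).
rewrite negb_forall_in => /exists_inP[p pD]; rewrite negb_forall_in => /exists_inP[q qb].
by rewrite negb_imply => /andP[qp qD]; exists p, q.
Qed.

Lemma ltn_sum_sets (T : finType) (A B : {set T}) (f : T -> nat) :
  #|A| = #|B| -> A != set0 -> {in A & B, forall a b, f a < f b} ->
  \sum_(a in A) f a < \sum_(b in B) f b.
Proof.
move=> eAB /set0Pn[a0 a0A] lt.
case: (@arg_maxnP _ a0 (mem A) f a0A) => a aA amax.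
apply: (@leq_ltn_trans (\sum_(x in A) f a)); first exact: leq_sum.
apply: (@leq_trans (\sum_(x in B) (f a).+1)).
  by rewrite !sum_nat_const eAB ltn_mul2l ltnSn andbT -eAB; apply/card_gt0P; exists a.
by apply: leq_sum => b bB; exact: lt.
Qed.

(** Exchanging the points of [S] outside of the segment for the equally many
    points of the segment outside of [S] moves every one of them to the front. *)
Lemma seg_sum_lt S (f : pt K m -> nat) : S \subset box n ->
    {in box n &, forall p q, lex p q -> f p < f q} -> S != seg n #|S| ->
  \sum_(p in seg n #|S|) f p < \sum_(p in S) f p.
Proof.
move=> Sb f_mono neS; set G := seg n #|S|.
have cG : #|G| = #|S| by rewrite card_seg // subset_leq_card.
rewrite (big_setID S) [X in _ < X](big_setID G) /= setIC ltn_add2l.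
have eC : #|G :\: S| = #|S :\: G|.
  by apply/eqP; rewrite -(eqn_add2l #|G :&: S|) cardsID setIC cardsID cG.
apply: ltn_sum_sets => //.
  apply: contra neS; rewrite setD_eq0 => GS.
  by rewrite eq_sym eqEcard GS cG /=.
move=> a b /setDP[aG aS] /setDP[bS bG].
have bb := subsetP Sb _ bS; have [Gb G_ini] := seg_initial #|S|.
have ab := subsetP Gb _ aG; apply: f_mono => //; apply: contraNT bG => /lexNge[->//|ba].
exact: G_ini aG bb ba.
Qed.

End Segments.

(** * Compression along a coordinate *)

Section Slices.
Variables (K m : nat) (n : 'I_m.+1 -> nat) (i : 'I_m.+1).
Implicit Types (c : 'I_K.+1) (p : pt K m.+1) (q : pt K m) (D : {set pt K m.+1}).

Definition ins c q : pt K m.+1 :=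
  [ffun j => if unlift i j is Some j' then q j' else c].

Definition del p : pt K m := [ffun j => p (lift i j)].

Definition slice c D : {set pt K m} := [set q | ins c q \in D].

Definition compress D : {set pt K m.+1} :=
  [set p | del p \in seg (n \o lift i) #|slice (p i) D|].

Lemma in_compress D p :
  (p \in compress D) = (del p \in seg (n \o lift i) #|slice (p i) D|).
Proof. exact: in_set. Qed.

Lemma ins_at c q : ins c q i = c.
Proof. by rewrite ffunE unlift_none. Qed.

Lemma ins_lift c q j : ins c q (lift i j) = q j.
Proof. by rewrite ffunE liftK. Qed.

Lemma insK c : cancel (ins c) del.
Proof. by move=> q; apply/ffunP => j; rewrite ffunE ins_lift. Qed.

Lemma delK p : ins (p i) (del p) = p.
Proof.
by apply/ffunP => j; case: (unliftP i j) => [j'|] ->; rewrite ?ins_at ?ins_lift ?ffunE.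
Qed.

Lemma deg_ins c q : deg (ins c q) = c + deg q.
Proof.
rewrite /deg (bigD1_ord i) //= ins_at; congr addn.
by apply: eq_bigr => j _; rewrite ins_lift.
Qed.

Lemma lex_ins c q q' : lex (ins c q) (ins c q') = lex q q'.
Proof.
have lt_lift (j k : 'I_m) : (lift i j < lift i k) = (j < k).
  by rewrite /= /bump; lia.
apply/lexP/lexP => -[j lj ej].
  case: (unliftP i j) => [j'|] ej'; last by rewrite ej' !ins_at ltnn in lj.
  move: lj ej; rewrite ej' !ins_lift => lj ej; exists j' => // k kj.
  by have := ej (lift i k); rewrite !ins_lift lt_lift => ->.
exists (lift i j); rewrite ?ins_lift // => k.
by case: (unliftP i k) => [k'|] ->; rewrite ?ins_at // !ins_lift lt_lift; exact: ej.
Qed.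

Lemma box_ins c q : (ins c q \in box n) = (c < n i) && (q \in box (n \o lift i)).
Proof.
apply/boxP/andP => [h|[ci /boxP h] j].
  by split; [have := h i; rewrite ins_at | apply/boxP => j; have := h (lift i j); rewrite ins_lift].
by case: (unliftP i j) => [j'|] ->; rewrite ?ins_at ?ins_lift //; exact: h.
Qed.

Lemma sum_slices D (f : pt K m.+1 -> nat) :
  \sum_(p in D) f p = \sum_c \sum_(q in slice c D) f (ins c q).
Proof.
rewrite pair_big_dep /= (reindex (fun cq : 'I_K.+1 * pt K m => ins cq.1 cq.2)) /=.
  by apply: eq_bigl => -[c q]; rewrite inE.
exists (fun p => (p i, del p)) => [[c q] _|p _] /=; last exact: delK.
by rewrite ins_at insK.
Qed.

Lemma slice_compress c D : slice c (compress D) = seg (n \o lift i) #|slice c D|.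
Proof. by apply/setP => q; rewrite inE in_compress ins_at insK. Qed.

Lemma slice_down c D : down n D -> down (n \o lift i) (slice c D).
Proof.
case=> Db Dd; split=> [|q q'].
  by apply/subsetP => q; rewrite inE => /(subsetP Db); rewrite box_ins => /andP[].
rewrite !inE => qD le; apply: Dd qD _ => j.
by case: (unliftP i j) => [j'|] ->; rewrite ?ins_at // !ins_lift.
Qed.

Lemma card_slice_compress c D : down n D -> #|slice c (compress D)| = #|slice c D|.
Proof.
by move=> /(slice_down c)[Db _]; rewrite slice_compress card_seg // subset_leq_card.
Qed.

Lemma card_compress D : down n D -> #|compress D| = #|D|.
Proof.
move=> Dd; rewrite -!sum1_card !sum_slices; apply: eq_bigr => c _.
by rewrite !sum1_card card_slice_compress.
Qed.

(** The slices of a downset decrease along direction [i]; segments are nested by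
    their sizes, so the compressed slices decrease as well. *)
Lemma compress_down D : down n D -> down n (compress D).
Proof.
move=> Dd; have [Db Dd'] := Dd.
split=> [|p p' pC le].
  apply/subsetP => p; rewrite in_compress -[p in p \in box _]delK box_ins => pC; apply/andP; split.
    move: pC; rewrite ltnNge; apply: contraL => pi.
    suff -> : slice (p i) D = set0 by rewrite cards0 in_seg ltn0 andbF.
    apply/setP => q; rewrite !inE; apply/negP => /(subsetP Db).
    by rewrite box_ins ltnNge pi.
  by apply: subsetP pC; have [] := seg_initial K (n \o lift i) #|slice (p i) D|.
move: pC; rewrite !in_compress => pC.
have leS : #|slice (p i) D| <= #|slice (p' i) D|.
  apply: subset_leq_card; apply/subsetP => q; rewrite !inE => /Dd'; apply=> j.
  by case: (unliftP i j) => [j'|] ->; rewrite ?ins_at ?ins_lift.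
apply: (subsetP (seg_sub K _ leS)).
have [_ sd] := initial_down (seg_initial K (n \o lift i) #|slice (p i) D|).
by apply: sd pC _ => j; rewrite !ffunE.
Qed.

(** The order on a slice is that of the whole box, so ranks add up to less in each
    slice that changes: this is what makes iterated compression terminate. *)
Lemma compress_sum_rank D : down n D -> compress D != D ->
  \sum_(p in compress D) rank n p < \sum_(p in D) rank n p.
Proof.
move=> Dd CD.
have rank_ins c : slice c D != set0 ->
    {in box (n \o lift i) &, forall q q' : pt K m, lex q q' -> rank n (ins c q) < rank n (ins c q')}.
  case/set0Pn => q0; rewrite inE => /(subsetP Dd.1); rewrite box_ins => /andP[ci _].
  by move=> q q' qb _ qq'; apply: rank_mono; rewrite ?lex_ins // box_ins ci.
have le c : \sum_(q in slice c (compress D)) rank n (ins c q) <=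
            \sum_(q in slice c D) rank n (ins c q) ?= iff (slice c (compress D) == slice c D).
  rewrite slice_compress; case: eqVneq => [->|ne]; first by split; rewrite ?eqxx.
  have lt : \sum_(q in seg (n \o lift i) #|slice c D|) rank n (ins c q) <
            \sum_(q in slice c D) rank n (ins c q).
    apply: seg_sum_lt; [exact: (slice_down c Dd).1 | apply: rank_ins | by rewrite eq_sym].
    apply: contra ne => /eqP->; rewrite cards0; apply/eqP/setP => q.
    by rewrite in_seg in_set0 ltn0 andbF.
  by split; [exact: ltnW | apply: ltn_eqF].
have [c ne] : exists c, slice c (compress D) != slice c D.
  apply/existsP; apply: contraNT CD => /existsPn h; apply/eqP/setP => p.
  have /negPn/eqP/setP/(_ (del p)) := h (p i).
  by rewrite !(inE, delK).
rewrite !sum_slices (bigD1 c) //= [X in _ < X](bigD1 c) //= -addSn leq_add //.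
  by rewrite ltn_neqAle (le c).2 ne (le c).1.
by apply: leq_sum => c' _; rewrite (le c').1.
Qed.

Lemma compress_fixed D (p q : pt K m.+1) : D \subset box n -> compress D = D -> p \in D -> q \in box n ->
  q i = p i -> lex q p -> q \in D.
Proof.
move=> Db eD; rewrite -[in p \in D]eD -{2}eD !in_compress => pD qb e qp.
rewrite e; have [_ si] := seg_initial K (n \o lift i) #|slice (p i) D|.
apply: si pD _ _; first by move: qb; rewrite -[q]delK box_ins insK => /andP[].
by rewrite -(lex_ins (p i)) delK -e delK.
Qed.

End Slices.

(** * Levels, and the planar case *)

Section Levels.
Variables (K m : nat).
Implicit Types (p : pt K m) (A B : {set pt K m}).

Definition lev A (g : nat) : {set pt K m} := [set p in A | deg p == g].

Lemma in_lev A g p : (p \in lev A g) = (p \in A) && (deg p == g).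
Proof. exact: in_set. Qed.

Lemma leq_card_lev A B : (forall g, #|lev A g| <= #|lev B g|) -> #|A| <= #|B|.
Proof.
move=> le; pose N := \max_(p : pt K m) deg p.
have cardE (C : {set pt K m}) : #|C| = \sum_(g < N.+1) #|lev C g|.
  rewrite -sum1_card (partition_big (fun p => inord (deg p) : 'I_N.+1) predT) //=.
  apply: eq_bigr => g _; rewrite -sum1_card; apply: eq_bigl => p; rewrite in_lev.
  by rewrite -val_eqE /= inordK // ltnS leq_bigmax.
by rewrite !cardE; apply: leq_sum.
Qed.

(** If the level sizes of [A] stay below those of [B] once they fall below, a deficit
    of [A] in degrees at most [d] could not be made up for in higher degrees. *)
Lemma low_crossing A B d : #|A| = #|B| ->
    (forall g, #|lev A g| < #|lev B g| -> forall g', g <= g' -> #|lev A g'| <= #|lev B g'|) ->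
  #|B :&: low d| <= #|A :&: low d|.
Proof.
move=> eAB cross.
have levI (C : {set pt K m}) g : lev (C :&: low d) g = if g <= d then lev C g else set0.
  apply/setP => p; rewrite in_lev !inE; case: ifP => gd; rewrite ?in_lev ?inE;
    by case: eqVneq => [->|]; rewrite ?gd ?andbT ?andbF.
have levD (C : {set pt K m}) g : lev (C :\: low d) g = if g <= d then set0 else lev C g.
  apply/setP => p; rewrite in_lev !inE; case: ifP => gd; rewrite ?in_lev ?inE;
    by case: eqVneq => [->|]; rewrite ?gd ?andbT ?andbF.
case: (boolP [exists g : 'I_d.+1, #|lev A g| < #|lev B g|]) => [/existsP[g /cross lt]|].
  have : #|A :\: low d| <= #|B :\: low d|.
    apply: leq_card_lev => g'; rewrite !levD; case: (leqP g' d) => // g'd.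
    by apply: lt; rewrite ltnW // (leq_ltn_trans _ g'd) // -ltnS.
  by have := cardsID (low d) A; have := cardsID (low d) B; lia.
move=> /existsPn h; apply: leq_card_lev => g; rewrite !levI; case: (leqP g d) => // gd.
by have := h (Ordinal (gd : g < d.+1)); rewrite -leqNgt.
Qed.

End Levels.

Section Planar.
Variables (K : nat) (n : 'I_2 -> nat).
Hypothesis n_mono : n ord0 <= n ord_max.
Implicit Types (p q : pt K 2) (D S : {set pt K 2}).

Lemma ord2P (P : 'I_2 -> Prop) : P ord0 -> P ord_max -> forall i, P i.
Proof.
move=> P0 P1 i; case: (unliftP ord0 i) => [j|] -> //.
by rewrite (_ : lift ord0 j = ord_max) //; apply: val_inj; rewrite [j]ord1.
Qed.

Definition pt2 u v : pt K 2 := [ffun i => inord (if i == ord0 then u else v)].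

Definition c0 p : nat := p ord0.
Definition c1 p : nat := p ord_max.

Lemma c0_le p : c0 p <= K. Proof. exact: ltn_ord (p ord0). Qed.
Lemma c1_le p : c1 p <= K. Proof. exact: ltn_ord (p ord_max). Qed.

Lemma pt2_fst u v : u <= K -> c0 (pt2 u v) = u.
Proof. by move=> uK; rewrite /c0 ffunE eqxx inordK. Qed.

Lemma pt2_snd u v : v <= K -> c1 (pt2 u v) = v.
Proof. by move=> vK; rewrite /c1 ffunE /= inordK. Qed.

Lemma deg2 p : deg p = c0 p + c1 p.
Proof.
by rewrite /deg big_ord_recl big_ord1 /c1 (_ : lift ord0 ord0 = ord_max) //; exact: val_inj.
Qed.

Lemma box2P p : reflect (c0 p < n ord0 /\ c1 p < n ord_max) (p \in box n).
Proof.
by apply: (iffP (boxP _ _)) => [h|[h0 h1]]; [split; exact: h | exact: ord2P].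
Qed.

Lemma pt2_eq p q : c0 p = c0 q -> c1 p = c1 q -> p = q.
Proof. by move=> e0 e1; apply: ptP; apply: ord2P. Qed.

Lemma lev_eq D g p q : p \in lev D g -> q \in lev D g ->
  c0 p = c0 q -> p = q.
Proof.
rewrite !in_lev !deg2 => /andP[_ /eqP ep] /andP[_ /eqP eq] e.
by apply: pt2_eq => //; lia.
Qed.

Lemma card_lev_le D g : #|lev D g| <= g.+1.
Proof.
rewrite -[g.+1]card_ord -(card_in_imset (f := fun p => inord (c0 p) : 'I_g.+1)).
  exact: max_card.
have le p : p \in lev D g -> c0 p < g.+1.
  by rewrite in_lev deg2 => /andP[_ /eqP]; lia.
move=> p q pL qL /(congr1 val) /=; rewrite !inordK ?le //; exact: lev_eq pL qL.
Qed.

Section Downset.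
Variable D : {set pt K 2}.
Hypothesis Dd : down n D.

Lemma down2 p u v : p \in D -> u <= c0 p -> v <= c1 p -> pt2 u v \in D.
Proof.
move=> pD up vp; apply: Dd.2 pD _.
have := c0_le p; have := c1_le p => p1 p0.
by apply: ord2P; [rewrite -/(c0 _) pt2_fst | rewrite -/(c1 _) pt2_snd] => //; lia.
Qed.

(** When level [g.+1] omits the column [w], mapping its points before [w] one step
    down and those after [w] one step left is injective.  Such a [w <= g] exists,
    as otherwise level [g] would be complete, with [g.+1] points. *)
Lemma lev_decr g : #|lev D g| <= g -> #|lev D g.+1| <= #|lev D g|.
Proof.
move=> c_le.
have [w wN] : exists w : 'I_g.+1, forall p, p \in lev D g.+1 -> c0 p != w.
  have : ~~ [forall w : 'I_g.+1, [exists p in lev D g.+1, c0 p == w]].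
    apply: contraL c_le => /forallP h; rewrite -ltnNge -[X in X <= _]card_ord.
    have in_L (w : 'I_g.+1) : (w <= K) /\ pt2 w (g - w) \in lev D g.
      have /exists_inP[p pL /eqP ew] := h w; move: pL; rewrite [p \in _]in_lev [deg p]deg2 => /andP[pD /eqP ep].
      have := ltn_ord w; have := c0_le p; have := c1_le p => p1 p0 wg.
      split; first lia.
      rewrite in_lev deg2 pt2_fst ?pt2_snd ?(down2 pD) /=; lia.
    rewrite -(card_imset (f := fun w : 'I_g.+1 => pt2 w (g - w))) //.
      by apply: subset_leq_card; apply/subsetP => _ /imsetP[w _ ->]; exact: (in_L w).2.
    move=> w w' /(congr1 (fun p : pt K 2 => c0 p)).
    by rewrite !pt2_fst ?(in_L _).1 // => /val_inj.
  rewrite negb_forall => /existsP[w]; rewrite negb_exists_in => /forall_inP h.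
  by exists w.
pose h p := if c0 p < w then pt2 (c0 p) (c1 p).-1 else pt2 (c0 p).-1 (c1 p).
have hK p : (c0 p <= K) * (c1 p <= K) * ((c0 p).-1 <= K) * ((c1 p).-1 <= K).
  have := c0_le p; have := c1_le p => p1 p0.
  by do !split; lia.
rewrite -(card_in_imset (f := h)).
  apply: subset_leq_card; apply/subsetP => _ /imsetP[p pL ->].
  have := wN p pL; move: pL; rewrite !in_lev /h deg2 => /andP[pD /eqP ep] pw.
  have wg := ltn_ord w.
  case: ltnP => pw'; rewrite (down2 pD) ?leq_pred //= deg2 pt2_fst ?pt2_snd ?hK //; lia.
move=> p q pL qL e; apply: (lev_eq pL qL).
have := wN p pL; have := wN q qL; move: e; rewrite /h.
by case: ltnP => pw; case: ltnP => qw /(congr1 (fun p : pt K 2 => c0 p));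
  rewrite !pt2_fst ?hK //; lia.
Qed.

(** In degree at least [n ord_max], the longer side, all points have positive
    coordinates, so both steps, down and left, are possible.  Besides the points one
    step down from level [g.+1], level [g] contains the one to the left of its first
    point. *)
Lemma lev_decr_strict g : n ord_max <= g.+1 -> 0 < #|lev D g.+1| ->
  #|lev D g.+1| < #|lev D g|.
Proof.
move=> ng /card_gt0P[p0 p0L].
case: (@arg_minnP _ p0 (mem (lev D g.+1)) (fun p => c0 p) p0L) => p pL pmin.
have hK q : (c0 q <= K) * (c1 q <= K) * ((c0 q).-1 <= K) * ((c1 q).-1 <= K).
  have := c0_le q; have := c1_le q => q1 q0'.
  by do !split; lia.
have bd q : q \in lev D g.+1 -> [/\ q \in D, 0 < c0 q, 0 < c1 q & c0 q + c1 q = g.+1].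
  rewrite in_lev deg2 => /andP[qD /eqP e].
  have /box2P[] := subsetP Dd.1 _ qD.
  by split=> //; lia.
pose h q := pt2 (c0 q) (c1 q).-1.
rewrite -(card_in_imset (f := h)); last first.
  move=> q q' qL q'L /(congr1 (fun p : pt K 2 => c0 p)).
  by rewrite !pt2_fst ?hK //; apply: lev_eq qL q'L.
apply: proper_card; apply/properP; split.
  apply/subsetP => _ /imsetP[q /bd[qD q0 q1 e] ->].
  by rewrite in_lev deg2 pt2_fst ?pt2_snd ?hK // (down2 qD) //=; lia.
have [pD pf ps e] := bd p pL.
exists (pt2 (c0 p).-1 (c1 p)).
  by rewrite in_lev deg2 pt2_fst ?pt2_snd ?hK // (down2 pD) //=; lia.
apply/imsetP => -[q qL /(congr1 (fun p : pt K 2 => c0 p))].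
have := pmin q qL; rewrite /h !pt2_fst ?hK //; lia.
Qed.

End Downset.

Definition cols (q : nat) : {set pt K 2} := [set p in box n | c0 p < q].

Lemma in_cols (q : nat) p : (p \in cols q) = (p \in box n) && (c0 p < q).
Proof. exact: in_set. Qed.

(** Stepping up is injective and leaves the box only from the top row, which meets
    level [g] in at most one point, and in none if [g.+1 < n ord_max]. *)
Lemma lev_cols_step (q g : nat) : n ord_max <= K.+1 ->
  #|lev (cols q) g| <= #|lev (cols q) g.+1| + (n ord_max <= g.+1).
Proof.
move=> nK.
pose T := [set p : pt K 2 | c1 p == (n ord_max).-1].
have TE p : (p \in T) = (c1 p == (n ord_max).-1) by exact: in_set.
rewrite -(cardsID T) addnC leq_add //.
  pose h p := pt2 (c0 p) (c1 p).+1.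
  have bd p : p \in lev (cols q) g :\: T ->
      [/\ c0 p <= K, c1 p < K, c0 p < n ord0, (c1 p).+1 < n ord_max
         & c0 p < q /\ c0 p + c1 p = g].
    rewrite in_setD in_lev in_cols TE deg2 => /andP[pT /andP[/andP[/box2P[]] pb0 pb1 pq /eqP e]].
    have := c0_le p.
    by split=> //; lia.
  rewrite -(card_in_imset (f := h)).
    apply: subset_leq_card; apply/subsetP => _ /imsetP[p /bd[p0 p1 p0n p1n [pq e]] ->].
    rewrite in_lev in_cols deg2 pt2_fst ?pt2_snd // pq addnS e eqxx !andbT.
    by apply/box2P; rewrite ?pt2_fst ?pt2_snd.
  move=> p p' pT p'T; have [p0 _ _ _ _] := bd p pT; have [p'0 _ _ _ _] := bd p' p'T.
  move=> /(congr1 (fun p : pt K 2 => c0 p)); rewrite !pt2_fst //.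
  by move: pT p'T => /setDP[pL _] /setDP[p'L _]; apply: lev_eq pL p'L.
case: (leqP (n ord_max) g.+1) => ng.
  apply/card_le1_eqP => p p' /setIP[pL pT] /setIP[p'L p'T]; apply: (lev_eq p'L pL).
  by move: pL pT p'L p'T; rewrite !in_lev !TE !deg2 => /andP[_ /eqP ?] /eqP ? /andP[_ /eqP ?] /eqP ?; lia.
rewrite leqn0 cards_eq0; apply/eqP/setP => p; rewrite in_setI in_lev in_cols TE deg2 in_set0.
by apply/negP => /andP[/andP[/andP[/box2P[? ?] _] /eqP ?] /eqP ?]; lia.
Qed.

(** Let [cols q] be the columns of [S] before its last one; they are full.  A level of
    [S] has at most one point more, so if a level [g] of [D] is smaller than that of [S], it is bounded by
    [#|lev (cols q) g|] and by [g]; the bound then propagates to all higher levels,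
    since the levels of [D] decrease at least as fast as those of [cols q]. *)
Lemma low_down_planar D S d : n ord_max <= K.+1 -> down n D -> initial n S ->
  #|D| = #|S| -> #|S :&: low d| <= #|D :&: low d|.
Proof.
move=> nK Dd [Sb S_ini] eDS; have [->|/set0Pn[s0 s0S]] := eqVneq S set0.
  by rewrite set0I cards0.
case: (@arg_maxnP _ s0 (mem S) (fun p => c0 p) s0S) => s sS smax.
pose q : nat := c0 s.
have colsS g : #|lev (cols q) g| <= #|lev S g|.
  apply: subset_leq_card; apply/subsetP => p; rewrite !in_lev in_cols => /andP[/andP[pb pq] ->].
  by rewrite andbT; apply: (S_ini s) => //; apply/lexP; exists ord0.
have Scols g : #|lev S g| <= (#|lev (cols q) g|).+1.
  pose T := [set p : pt K 2 | c0 p < q].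
  have TE p : (p \in T) = (c0 p < q) by exact: in_set.
  rewrite -(cardsID T) -[X in _ <= X]addn1 leq_add //.
    apply: subset_leq_card; apply/subsetP => p; rewrite in_setI !in_lev in_cols TE.
    by move=> /andP[/andP[pS ->] ->]; rewrite (subsetP Sb).
  apply/card_le1_eqP => p p' /setDP[pL pT] /setDP[p'L p'T]; apply: (lev_eq p'L pL).
  move: pL pT p'L p'T; rewrite !in_lev !TE => /andP[/smax /= ? _] pT' /andP[/smax /= ? _] p'T'.
  by move: pT' p'T'; rewrite -!leqNgt /q; lia.
apply: low_crossing => // g lt.
have : #|lev D g| <= minn #|lev (cols q) g| g.
  by have := Scols g; have := card_lev_le S g; lia.
move=> inv g' /subnKC <-; apply: leq_trans (colsS _).
suff : #|lev D (g + (g' - g))| <= minn #|lev (cols q) (g + (g' - g))| (g + (g' - g)) by lia.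
elim: (g' - g) => [|k IH]; first by rewrite addn0.
rewrite addnS; move: (g + k) IH => h IH.
have := lev_decr Dd (g := h); have := lev_decr_strict Dd (g := h).
by have := lev_cols_step q h nK; case: leqP; lia.
Qed.
End Planar.

(** * Lexicographic segments have the fewest points of low degree *)

Definition low_seg_minimal K m (n : 'I_m -> nat) := forall (D : {set pt K m}) d,
  down n D -> #|(seg n #|D| : {set pt K m}) :&: low d| <= #|D :&: low d|.

Lemma compress_low K m (n : 'I_m.+1 -> nat) i (D : {set pt K m.+1}) d :
  low_seg_minimal K (n \o lift i) -> down n D ->
  #|compress n i D :&: low d| <= #|D :&: low d|.
Proof.
move=> IH Dd.
have slice_low (c : 'I_K.+1) (E : {set pt K m.+1}) :
    slice i c (E :&: low d) = if c <= d then slice i c E :&: low (d - c) else set0.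
  apply/setP => q; rewrite in_set in_setI [_ \in low d]in_set deg_ins.
  case: (leqP c d) => cd; first by rewrite in_setI [_ \in low _]in_set in_set leq_subRL.
  by rewrite in_set0 leqNgt (leq_trans cd) ?leq_addr ?andbF.
rewrite -!sum1_card !(sum_slices i); apply: leq_sum => c _.
rewrite !sum1_card !slice_low; case: (leqP c d) => // _.
rewrite slice_compress; apply: IH; exact: slice_down.
Qed.

(** The points below a first gap precede it, hence are in [D] already, and no other
    point of [D] is above its last point. *)
Lemma swap_down K m (n : 'I_m -> nat) (D : {set pt K m}) x y : down n D ->
    x \in box n -> x \notin D -> y \in D -> lex x y ->
    {in box n, forall q, lex q x -> q \in D} -> {in D, forall p, ~~ lex y p} ->
  down n (x |: (D :\ y)).
Proof.
move=> [Db Dd] xb xD yD xy xmin ymax; split=> [|p q].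
  by apply/subsetP => p /setU1P[->//|/setD1P[_ /(subsetP Db)]].
move=> /setU1P[->|/setD1P[py pD]] le.
  have [->|qx] := le_lex le; first exact: setU11.
  have qb : q \in box n by apply/boxP => i; exact: leq_ltn_trans (le i) (boxP _ _ xb i).
  apply/setU1P; right; apply/setD1P; split; last exact: xmin.
  by apply: contraTneq qx => ->; rewrite (lex_asym xy).
apply/setU1P; right; apply/setD1P; split; last exact: Dd le.
apply: contraNneq (ymax p pD) => eq; have [e|] := le_lex le; last by rewrite eq.
by rewrite -e eq eqxx in py.
Qed.

(** Write [x = (x_0, ..., x_l)] and [y = (y_0, ..., y_l)].  The point
    [(x_0, top, ..., top, y_l)] is before [y] with the same last coordinate, hence in
    [D]; it shares its first coordinate with the gap [x], so it is before [x], which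
    forces [x = (x_0, top, ..., top, x_l)] with [y_l < x_l].  Dually,
    [(y_0, 0, ..., 0, x_l)] is not in [D], which forces [y = (y_0, 0, ..., 0, y_l)].
    The middle coordinates of [x] then compensate for [x_0 < y_0]: there is at least
    one of them, of value at least [n ord0 - 1 >= y_0]. *)
Lemma compressed_gap_deg K m (n : 'I_m.+3 -> nat) (D : {set pt K m.+3}) x y :
    (forall i, n i <= K.+1) -> (forall i j : 'I_m.+3, i <= j -> n i <= n j) ->
    D \subset box n -> compress n ord0 D = D -> compress n ord_max D = D ->
    x \in box n -> x \notin D -> y \in D -> lex x y ->
  deg y <= deg x.
Proof.
move=> nK n_mono Db fix0 fixm xb xD yD xy.
have yb := subsetP Db _ yD; have xbi := boxP _ _ xb; have ybi := boxP _ _ yb.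
have cf0 p q := compress_fixed (p := p) (q := q) Db fix0.
have cfm p q := compress_fixed (p := p) (q := q) Db fixm.
have xy0 : x ord0 < y ord0.
  have [i xyi eqi] := lexP _ _ xy; have [i0|i0] := posnP i.
    by rewrite (_ : ord0 = i) //; apply: val_inj.
  by case/negP: xD; apply: (cf0 y) => //; exact: eqi.
pose z1 : pt K m.+3 := [ffun j => if j == ord0 then x j else
                                  if j == ord_max then y j else inord (n j).-1].
pose z2 : pt K m.+3 := [ffun j => if j == ord0 then y j else
                                  if j == ord_max then x j else ord0].
have z1_0 : z1 ord0 = x ord0 by rewrite ffunE.
have z2_0 : z2 ord0 = y ord0 by rewrite ffunE.
have z1_m : z1 ord_max = y ord_max by rewrite ffunE eqxx.
have z2_m : z2 ord_max = x ord_max by rewrite ffunE eqxx.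
have z1_mid j : j != ord0 -> j != ord_max -> z1 j = (n j).-1 :> nat.
  move=> /negbTE j0 /negbTE jm; rewrite ffunE j0 jm inordK //.
  by have := nK j; have := xbi j; lia.
have z2_mid j : j != ord0 -> j != ord_max -> z2 j = 0 :> nat.
  by move=> /negbTE j0 /negbTE jm; rewrite ffunE j0 jm.
have z1b : z1 \in box n.
  apply/boxP => j; have [->|j0] := eqVneq j ord0; first by rewrite z1_0.
  have [->|jm] := eqVneq j ord_max; first by rewrite z1_m.
  by rewrite z1_mid //; have := xbi j; lia.
have z2b : z2 \in box n.
  apply/boxP => j; have [->|j0] := eqVneq j ord0; first by rewrite z2_0.
  have [->|jm] := eqVneq j ord_max; first by rewrite z2_m.
  by rewrite z2_mid //; have := xbi j; lia.
have z1D : z1 \in D by apply: (cfm y) => //; apply/lexP; exists ord0; rewrite ?z1_0.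
have [zx|/lexP[i zxi ezx]] : z1 = x \/ lex z1 x.
- by apply: lexNge; apply: contra xD => xz; apply: (cf0 z1).
- by rewrite -zx z1D in xD.
have im : i = ord_max.
  apply/eqP; apply: contraLR zxi => im; rewrite -leqNgt.
  have [->|i0] := eqVneq i ord0; first by rewrite z1_0.
  by rewrite z1_mid //; have := xbi i; lia.
rewrite im z1_m in zxi ezx.
have z2D : z2 \notin D.
  apply: contra xD => z2D; apply: (cfm z2) => //.
  by apply/lexP; exists ord0; rewrite ?z2_0.
have [yz|/lexP[k yzk eyz]] : y = z2 \/ lex y z2.
- by apply: lexNge; apply: contra z2D => zy; apply: (cf0 y).
- by rewrite -yz yD in z2D.
have km : k = ord_max.
  apply/eqP; apply: contraLR yzk => km; rewrite -leqNgt.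
  have [->|k0] := eqVneq k ord0; first by rewrite z2_0.
  by rewrite z2_mid.
rewrite km in eyz.
have lt_max (j : 'I_m.+3) : j != ord_max -> j < (ord_max : 'I_m.+3).
  by rewrite -val_eqE /=; have := ltn_ord j; lia.
pose j1 : 'I_m.+3 := Ordinal (isT : 1 < m.+3).
rewrite /deg (bigD1 ord0) // (bigD1 ord_max) //= [X in _ + (_ + X)]big1; last first.
  by move=> j /andP[j0 jm]; rewrite eyz ?lt_max // z2_mid.
rewrite (bigD1 ord0) // [X in _ <= _ + X](bigD1 ord_max) //=.
rewrite [X in _ <= _ + (_ + X)](bigD1 j1) //=.
have yx1 : y ord0 <= x j1.
  rewrite -ezx // z1_mid // -ltnS prednK; last exact: leq_ltn_trans (xbi j1).
  exact: leq_trans (ybi ord0) (n_mono _ _ _).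
rewrite addn0 addnC; apply: leq_trans (leq_addl _ _).
by rewrite addnA; apply: leq_trans (leq_addr _ _); exact: leq_add (ltnW zxi) yx1.
Qed.

(** Induction on the dimension, then on the sum of the ranks of [D]. *)
Theorem low_segP K m (n : 'I_m -> nat) :
    (forall i, n i <= K.+1) -> (forall i j : 'I_m, i <= j -> n i <= n j) ->
  low_seg_minimal K n.
Proof.
elim: m n => [|m IHm] n nK n_mono D d Dd.
  suff /initial_seg <- : initial n D by [].
  by split=> [|p q pD _ _]; [exact: Dd.1 | apply: Dd.2 pD _; case].
case: m => [|[|m]] in IHm n nK n_mono D Dd *.
- suff /initial_seg <- : initial n D by [].
  split=> [|p q pD _ /lexP[i qp _]]; first exact: Dd.1.
  by apply: Dd.2 pD _ => j; rewrite !(ord1 j) (ord1 i) in qp *; exact: ltnW.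
- apply: (low_down_planar (n := n)) => //; [exact: n_mono | exact: seg_initial | ].
  by rewrite card_seg // subset_leq_card // Dd.1.
have IH i : low_seg_minimal K (n \o lift i).
  apply: IHm => [j|j k jk] /=; [exact: nK | apply: n_mono => /=].
  by rewrite /bump; lia.
move: {2}(\sum_(p in D) _) (leqnn (\sum_(p in D) rank n p)) => N.
elim/ltn_ind: N D Dd => N IHN D Dd DN.
have [<-//|Dseg] := eqVneq D (seg n #|D|).
have step i : compress n i D != D -> #|(seg n #|D| : {set pt K m.+3}) :&: low d| <= #|D :&: low d|.
  move=> cD; apply: leq_trans (compress_low d (IH i) Dd).
  rewrite -(card_compress i Dd); apply: (IHN _ _ _ (compress_down i Dd) (leqnn _)).
  exact: leq_trans (compress_sum_rank Dd cD) DN.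
have [fix0|/step//] := eqVneq (compress n ord0 D) D.
have [fixm|/step//] := eqVneq (compress n ord_max D) D.
have [p [q [pD qb qD qp]]] := not_initialP Dd.1 Dseg.
have qC : q \in box n :\: D by rewrite inE qD.
case: (@arg_minnP _ q (mem (box n :\: D)) (rank n) qC) => x /setDP[xb xD] xmin.
case: (@arg_maxnP _ p (mem D) (rank n) pD) => y yD0 ymax.
have {yD0} yD : y \in D by [].
have Db := subsetP Dd.1.
have xy : lex x y.
  rewrite -(rank_le_lex xb (Db y yD)); apply: leq_ltn_trans (xmin q qC) _.
  by apply: leq_trans (ymax p pD); apply: rank_mono.
have degxy := compressed_gap_deg nK n_mono Dd.1 fix0 fixm xb xD yD xy.
pose D' := x |: (D :\ y).
have xDy : x \notin D :\ y by rewrite !inE negb_and xD orbT.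
have cD' : #|D'| = #|D| by rewrite cardsU1 xDy (cardsD1 y D) yD.
have D'd : down n D'.
  apply: swap_down => // [z zb zx|z zD].
    apply: contraLR zx => zD; rewrite -(rank_le_lex zb xb) -leqNgt.
    by apply: xmin; rewrite /= inE zD.
  by rewrite -(rank_le_lex (Db y yD) (Db z zD)) -leqNgt; exact: ymax.
have sumD' f : \sum_(z in D') f z + f y = \sum_(z in D) f z + f x.
  rewrite big_setU1 //= (big_setD1 y yD) /=.
  by rewrite addnC [f x + _]addnC addnA.
apply: (@leq_trans #|D' :&: low d|); last first.
  have cE (E : {set pt K m.+3}) : #|E :&: low d| = \sum_(z in E) (deg z <= d).
    rewrite -sum1_card (eq_bigl (fun z => (z \in E) && (deg z <= d))) ?big_mkcondr //=.
    by move=> z; rewrite in_setI [z \in low d]in_set.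
  rewrite !cE -(leq_add2r (deg y <= d)) (sumD' (fun z => nat_of_bool (deg z <= d))) leq_add2l.
  by case: (leqP (deg x) d) => // /(leq_trans degxy) ->.
rewrite -cD'; apply: (IHN (\sum_(z in D') rank n z)) => //.
apply: leq_trans DN; rewrite -(ltn_add2r (rank n y)) (sumD' (rank n)) ltn_add2l.
exact: rank_mono.
Qed.

(** * Ranks and the largest exponents *)

(** The summand of index [i] counts the points that agree with [a] before [i] and are
    smaller at [i]: the later coordinates are free. *)
Lemma rankE K m (n : 'I_m -> nat) (a : pt K m) :
    (forall i, n i <= K.+1) -> a \in box n ->
  rank n a = \sum_(i < m) a i * \prod_(j < m | i < j) n j.
Proof.
move=> nK ab; pose B (i j : 'I_m) := [pred k : 'I_K.+1 | if j < i then k == a j else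
                                   if j == i then k < a i else k < n j].
have cardB i : #|(family (B i) : pred (pt K m))| = a i * \prod_(j < m | i < j) n j.
  rewrite card_family foldrE big_map big_enum /= (bigID (fun j : 'I_m => i < j)) /=.
  rewrite mulnC; congr (_ * _).
    rewrite (bigD1 i) /= ?ltnn // big1 => [|j /andP[ij ji]]; last first.
      have lt : j < i by rewrite ltn_neqAle ji leqNgt.
      by rewrite -(card1 (a j)); apply: eq_card => k; rewrite unfold_in /= lt.
    rewrite muln1 -[RHS](@card_ord_lt K.+1) 1?ltnW ?ltn_ord //.
    by apply: eq_card => k; rewrite unfold_in /= eqxx.
  apply: eq_bigr => j ij; rewrite -[RHS](card_ord_lt (nK j)); apply: eq_card => k.
  by rewrite unfold_in /= ltnNge (ltnW ij) /= -val_eqE /= gtn_eqF.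
under [RHS]eq_bigr do rewrite -cardB -sum1_card.
rewrite [RHS](exchange_big_dep [pred q | (q \in box n) && lex q a]) /=; last first.
  move=> i q _ /familyP qF; apply/andP; split.
    apply/boxP => j; have := qF j; rewrite inE; case: ltnP => ji.
      by move=> /eqP->; exact: (boxP _ _ ab).
    case: eqP => [-> /ltn_trans -> //|_ //]; exact: (boxP _ _ ab).
  apply/lexP; exists i => [|j ji]; first by have := qF i; rewrite inE ltnn eqxx.
  by have := qF j; rewrite inE ji => /eqP.
rewrite /rank cardsE -sum1_card; apply: eq_bigr => q /andP[qb /lexP[i qai eqi]].
rewrite (big_pred1 i) // => k; rewrite /=; apply/familyP/eqP => [qF|-> j].
  case: (ltngtP k i) => [ki|ik|/val_inj//].
    by have := qF k; rewrite inE ltnn eqxx eqi ?ltnn.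
  by have := qF i; rewrite inE ik => /eqP qa; rewrite qa ltnn in qai.
rewrite inE; case: ltnP => [/eqi->//|ij]; case: eqP => [->//|_]; exact: (boxP _ _ qb).
Qed.

Section FirstExponents.
Variables (K m : nat) (n : 'I_m -> nat) (d : nat).
Hypothesis nK : forall i, n i <= K.+1.
Implicit Types (p q : pt K m) (a b : 'X_{1..m}).

Let s := Fle_desc n d.

Lemma mem_desc a : (a \in s) = (a \in Fle n d).
Proof. by rewrite mem_sort. Qed.

Lemma size_desc : size s = size (Fle n d).
Proof. by rewrite size_sort. Qed.

Lemma desc_uniq : uniq s.
Proof. by rewrite sort_uniq Fle_uniq. Qed.

Lemma desc_nth_lexge i j : i <= j -> j < size s -> lexge (nth 0%MM s i) (nth 0%MM s j).
Proof.
move=> ij js; apply: (sorted_leq_nth (@lexge_trans m)) => //.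
- by move=> a; rewrite /lexge eqxx.
- exact: (sort_sorted (@lexge_total m)).
- exact: leq_ltn_trans js.
Qed.

Definition of_expo a : pt K m := [ffun i => inord (a i)].

Lemma expoK : cancel (@expo K m) of_expo.
Proof. by move=> p; apply/ffunP => i; rewrite ffunE mnmE inord_val. Qed.

Lemma of_expoK a : (forall i, a i < n i) -> expo (of_expo a) = a.
Proof.
by move=> an; apply/mnmP => i; rewrite mnmE ffunE inordK // (leq_trans (an i)).
Qed.

Lemma mdeg_expo p : mdeg (expo p) = deg p.
Proof. by rewrite mdegE; apply: eq_bigr => i _; rewrite mnmE. Qed.

Lemma expo_Fle p : (expo p \in Fle n d) = (p \in box n :&: low d).
Proof.
rewrite mem_Fle mdeg_expo in_setI andbC [p \in low d]in_set; congr (_ && _).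
by apply/forallP/boxP => h i; have := h i; rewrite mnmE.
Qed.

Lemma Fle_expoP a : a \in Fle n d -> expo (of_expo a) = a.
Proof. by rewrite mem_Fle => /andP[_ /forallP]; exact: of_expoK. Qed.

Section Rth.
Variable k : nat.
Hypothesis ks : k < size s.
Let a := nth 0%MM s k.

Lemma nth_desc_Fle j : j <= k -> nth 0%MM s j \in Fle n d.
Proof. by move=> jk; rewrite -mem_desc mem_nth // (leq_ltn_trans jk). Qed.

Lemma desc_nth_lex j : j <= k -> ~~ lexlt (nth 0%MM s j) a.
Proof.
move=> jk; have := desc_nth_lexge jk ks; rewrite -/a.
have aF := Fle_expoP (nth_desc_Fle (leqnn k)); have bF := Fle_expoP (nth_desc_Fle jk).
rewrite -/a in aF; rewrite -aF -bF /lexge -!/(lex _ _) => /predU1P[/(can_inj expoK)->|/lex_asym ->//].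
by rewrite lexxx.
Qed.

Lemma lexlt_desc b : b \in Fle n d -> lexlt a b -> index b s < k.
Proof.
move=> bF ab; have bs : b \in s by rewrite mem_desc.
rewrite ltnNge; apply/negP => kb; have := desc_nth_lexge kb; rewrite index_mem nth_index // -/a => /(_ bs).
have aF := Fle_expoP (nth_desc_Fle (leqnn k)); rewrite -/a in aF.
rewrite -aF -(Fle_expoP bF) /lexge -/(lex _ _) in ab * => /predU1P[/(can_inj expoK) e|/lex_asym e].
  by rewrite -e lexxx in ab.
by rewrite e in ab.
Qed.

Lemma card_low_above : #|[set q in (box n : {set pt K m}) :&: low d | lex (of_expo a) q]| <= k.
Proof.
set T := finset _; have -> : k = size (take k s) by rewrite size_take ks.
rewrite cardE -(size_map (@expo K m)); apply: uniq_leq_size.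
  by rewrite (map_inj_uniq (can_inj expoK)) enum_uniq.
move=> b /mapP[q]; rewrite mem_enum inE -expo_Fle => /andP[qF aq] ->.
have aF := Fle_expoP (nth_desc_Fle (leqnn k)); rewrite -/a in aF.
by rewrite in_take ?mem_desc // lexlt_desc // -aF.
Qed.

(** If [p] is after [a], with first difference at [i], raise [a] by one at [i] and drop
    the later coordinates: the result is below [p], and is one of the exponents
    before [a] in the descending enumeration, unless its degree exceeds [d].  In
    that case the coordinates of [a] up to [i] already add up to [d], the later
    ones vanish, and [a] itself is below [p]. *)
Lemma desc_dominates p : p \in box n -> ~~ lex p (of_expo a) ->
  exists2 j, j <= k & forall i, nth 0%MM s j i <= p i.
Proof.
move=> pb pa; have aF := nth_desc_Fle (leqnn k); have aE := Fle_expoP aF.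
rewrite -/a in aF aE.
have aEi i : a i = of_expo a i by rewrite -[in LHS]aE mnmE.
have adom : (forall i, of_expo a i <= p i) -> exists2 j, j <= k & forall i, nth 0%MM s j i <= p i.
  by move=> h; exists k => // i; rewrite -/a aEi.
have [e|/lexP[i api eqi]] := lexNge pa; first by apply: adom => i; rewrite e.
have ad : mdeg a <= d by move: aF; rewrite mem_Fle => /andP[].
have [full|lt_d] := leqP d (\sum_(j < m | j <= i) of_expo a j).
  apply: adom => j; case: (ltngtP j i) => [/eqi->//|ij|/val_inj->]; last exact: ltnW.
  have : of_expo a j = 0 :> nat.
    have : \sum_(j < m) of_expo a j <= d.
      by apply: leq_trans ad; rewrite mdegE leq_sum // => l _; rewrite aEi.
    rewrite (bigID (fun j : 'I_m => j <= i)) /= (bigD1 (P := fun l => ~~ _) j) /= -?ltnNge //.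
    move=> /leq_trans/(_ full); rewrite -[X in _ <= X]addn0 leq_add2l leqn0 addn_eq0.
    by case/andP => /eqP.
  by move=> ->.
pose c : pt K m := [ffun j : 'I_m => if j < i then p j else if j == i then inord (of_expo a i).+1 else ord0].
have ci : c i = (of_expo a i).+1 :> nat.
  by rewrite ffunE ltnn eqxx inordK // (leq_ltn_trans api).
have c_lt (j : 'I_m) : j < i -> c j = of_expo a j by rewrite ffunE => ji; rewrite ji eqi.
have c_gt (j : 'I_m) : i < j -> c j = 0 :> nat.
  by move=> ij; rewrite ffunE ltnNge ltnW //= -val_eqE gtn_eqF.
have cp j : c j <= p j.
  by case: (ltngtP j i) => [ji|/c_gt->//|/val_inj->]; [rewrite c_lt // eqi | rewrite ci].
have cF : expo c \in Fle n d.
  rewrite expo_Fle in_setI; apply/andP; split.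
    by apply/boxP => j; exact: leq_ltn_trans (cp j) (boxP _ _ pb j).
  rewrite in_set /deg (bigID (fun j : 'I_m => j <= i)) /= [X in _ + X]big1 => [|j]; last first.
    by rewrite -ltnNge => /c_gt.
  rewrite addn0; apply: leq_trans lt_d; rewrite (bigD1 i) //= [X in _ <= X.+1](bigD1 i) //=.
  rewrite ci addSn ltnS leq_add2l leq_sum // => j /andP[ji ne].
  by rewrite c_lt // ltn_neqAle ji andbT.
exists (index (expo c) s) => [|j]; last by rewrite nth_index ?mem_desc // mnmE.
apply/ltnW/lexlt_desc => //; rewrite -[a]aE; apply/lexP; exists i => [|j ji].
  by rewrite ci.
by rewrite c_lt.
Qed.

End Rth.
End FirstExponents.
Arguments of_expo K {m} a.

(** * The grid as a box *)

Import GRing.Theory.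
Local Open Scope ring_scope.

Section GridPoints.
Variables (F : fieldType) (K m : nat) (A : 'I_m -> {fset F}).
Let n i := #|` A i|.
Hypothesis nK : forall i, (n i <= K.+1)%N.

Definition pt_of (x : grid A) : pt K m := [ffun i => inord (index (grid_pt x i) (A i))].

Lemma grid_ptP (x : grid A) i : grid_pt x i \in A i.
Proof. exact: valP. Qed.

Lemma pt_ofE x i : pt_of x i = index (grid_pt x i) (A i) :> nat.
Proof. by rewrite ffunE inordK // (leq_trans _ (nK i)) // index_mem grid_ptP. Qed.

Lemma nth_pt_of x i : nth 0 (A i) (pt_of x i) = grid_pt x i.
Proof. by rewrite pt_ofE nth_index // grid_ptP. Qed.

Lemma pt_of_inj : injective pt_of.
Proof.
move=> x y e; apply/ffunP => i; apply: val_inj.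
by rewrite -[LHS]/(grid_pt x i) -nth_pt_of e nth_pt_of.
Qed.

Lemma pt_of_box x : pt_of x \in box n.
Proof. by apply/boxP => i; rewrite pt_ofE index_mem grid_ptP. Qed.

Lemma pt_of_onto p : p \in box n -> exists x, pt_of x = p.
Proof.
move=> /boxP pb.
pose x : grid A := [ffun i => FSetSub (mem_nth 0 (pb i) : nth 0 (A i) (p i) \in A i)].
exists x; apply: ptP => i; rewrite pt_ofE /grid_pt ffunE /= index_uniq ?fset_uniq //; exact: (pb i).
Qed.

Lemma card_grid (P : pred (pt K m)) :
  #|[set x : grid A | P (pt_of x)]| = #|[set p in box n | P p]|.
Proof.
rewrite -(card_imset _ pt_of_inj); apply: eq_card => p; rewrite inE.
apply/imsetP/andP => [[x xP ->]|[/pt_of_onto[x <-] px]].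
  by rewrite pt_of_box; move: xP; rewrite inE.
by exists x; rewrite // inE.
Qed.

End GridPoints.

(** * The footprint bound *)

Section Footprint.
Variables (F : fieldType) (m : nat) (A : 'I_m -> {fset F}).
Implicit Types (p q f : {mpoly F[m]}) (a b : 'X_{1..m}).

Definition root_prod (i : 'I_m) (s : seq F) : {mpoly F[m]} := \prod_(c <- s) ('X_i - c%:MP).

Lemma root_prodE i s (x : 'I_m -> F) : (root_prod i s).@[x] = \prod_(c <- s) (x i - c).
Proof.
rewrite /root_prod (big_morph _ (mevalM x) (meval1 x)).
by apply: eq_bigr => c _; rewrite mevalB mevalXU mevalC.
Qed.

Lemma ltom0_mnm1 (i : 'I_m) : ((0%MM : 'X_{1..m}) < U_(i)%MM)%O.
Proof. by rewrite Order.POrderTheory.lt_neqAle le0m eq_sym mnm1_eq0. Qed.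

Lemma mlead_XsubC i (c : F) : mlead ('X_i - c%:MP : {mpoly F[m]}) = U_(i)%MM.
Proof. by rewrite mleadDl mleadXm // mleadN mleadC ltom0_mnm1. Qed.

Lemma XsubC_neq0 i (c : F) : ('X_i - c%:MP : {mpoly F[m]}) != 0.
Proof.
by apply: contraTneq (ltom0_mnm1 i) => e; rewrite -(mlead_XsubC i c) e mlead0 Order.POrderTheory.ltxx.
Qed.

Lemma root_prod_neq0 i s : root_prod i s != 0.
Proof. by rewrite prodf_seq_neq0; apply/allP => c _; exact: XsubC_neq0. Qed.

Lemma mlead_root_prod i s : mlead (root_prod i s) = (U_(i) *+ size s)%MM.
Proof.
rewrite mlead_prod => [|c _ _]; last exact: XsubC_neq0.
under eq_bigr do rewrite mlead_XsubC.
by elim: s => [|c s IH]; rewrite ?big_nil ?big_cons ?mulm0n //= IH mulmS.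
Qed.

Section Evaluation.
Variable (Z : {set grid A}).

Definition ev p : 'rV[F]_#|Z| := \row_k p.@[grid_pt (enum_val k)].

Lemma ev_linear c p q : ev (c *: p + q) = c *: ev p + ev q.
Proof. by apply/rowP => k; rewrite !mxE mevalD mevalZ. Qed.

Lemma ev_scale c p : ev (c *: p) = c *: ev p.
Proof. by apply/rowP => k; rewrite !mxE mevalZ. Qed.

Lemma ev_sub N (M : 'M[F]_(N, #|Z|)) p :
  {in msupp p, forall a, (ev 'X_[a] <= M)%MS} -> (ev p <= M)%MS.
Proof.
move=> le; rewrite [p]mpolyE big_seq; elim/big_ind: _ => [|u v uM vM|a /le aM].
- by rewrite (_ : ev 0 = 0) ?sub0mx //; apply/rowP => k; rewrite !mxE meval0.
- by rewrite -[u]scale1r ev_linear scale1r addmx_sub.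
- by rewrite ev_scale scalemx_sub.
Qed.

(** On [Z], subtracting a multiple of [f] rewrites a monomial divisible by the
    leading monomial of [f] into smaller ones. *)
Lemma ev_reduce N (M : 'M[F]_(N, #|Z|)) f a :
    f != 0 -> ev f = 0 -> (mlead f <= a)%MM ->
    (forall b, (b < a)%O -> (ev 'X_[b] <= M)%MS) ->
  (ev 'X_[a] <= M)%MS.
Proof.
move=> f0 ef fa IH; pose g := f * 'X_[a - mlead f].
have X0 : 'X_[a - mlead f] != 0 :> {mpoly F[m]} by rewrite -msupp_eq0 msuppX.
have g0 : g != 0 by rewrite mulf_neq0.
have ga : mlead g = a.
  by rewrite mleadM // mleadXm addmC submK.
have eg : ev g = 0.
  apply/rowP => k; rewrite !mxE mevalM; move/rowP/(_ k): ef; rewrite !mxE => ->.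
  by rewrite mul0r.
have c0 : g@_a != 0 by rewrite -ga mleadc_eq0.
pose q := 'X_[a] - (g@_a)^-1 *: g.
have -> : ev 'X_[a] = ev q.
  by rewrite /q addrC -scaleNr ev_linear eg scaler0 add0r.
apply: ev_sub => b bq; apply: IH; have ba : (b <= a)%O.
  move: bq; rewrite -[(_ <= _)%O]negbK -Order.TotalTheory.ltNge; apply: contraL => ab.
  have gb : g@_b = 0 by apply: mcoeff_gt_mlead; rewrite ga.
  by rewrite -mcoeff_eq0 mcoeffB mcoeffZ mcoeffX gb (Order.POrderTheory.lt_eqF ab) mulr0 subr0.
rewrite Order.POrderTheory.lt_neqAle ba andbT; apply: contraTneq bq => ->.
by rewrite -mcoeff_eq0 mcoeffB mcoeffZ mcoeffX eqxx mulVf // subrr.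
Qed.

(** The row space of [M] contains the indicator function of each point of [Z], by
    interpolation on the grid, so [M] has rank [#|Z|]. *)
Lemma full_ev N (M : 'M[F]_(N, #|Z|)) : (forall p, (ev p <= M)%MS) -> (#|Z| <= N)%N.
Proof.
move=> le; rewrite -(mxrank1 F #|Z|); apply: leq_trans (rank_leq_row M).
apply: mxrankS; apply/row_subP => k; set x := enum_val k.
pose p := \prod_i root_prod i [seq c <- A i | c != grid_pt x i].
have px (y : grid A) : p.@[grid_pt y] = \prod_i \prod_(c <- [seq c <- A i | c != grid_pt x i]) (grid_pt y i - c).
  rewrite (big_morph _ (mevalM _) (meval1 _)); apply: eq_bigr => i _; exact: root_prodE.
have c0 : p.@[grid_pt x] != 0.
  rewrite px; apply/prodf_neq0 => i _; rewrite prodf_seq_neq0; apply/allP => c.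
  by rewrite mem_filter subr_eq0 eq_sym => /andP[->].
suff -> : row k 1%:M = (p.@[grid_pt x])^-1 *: ev p by apply: scalemx_sub.
apply/rowP => j; rewrite !mxE; case: eqVneq => [<-|kj]; first by rewrite mulVf.
rewrite mulr0n (px (enum_val j)).
have [i ne] : exists i, grid_pt (enum_val j) i != grid_pt x i.
  apply/existsP; apply: contraNT kj => /existsPn e; apply/eqP/enum_val_inj/ffunP => i.
  by apply: val_inj; have /negPn/eqP := e i.
rewrite (bigD1 i) //= (bigD1_seq (grid_pt (enum_val j) i)) /=.
- by rewrite subrr !mul0r mulr0.
- by rewrite mem_filter ne grid_ptP.
- by rewrite filter_uniq // fset_uniq.
Qed.

End Evaluation.

(** Monomials outside of the box are reduced by the polynomials vanishing on a whole
    [A i], the others by those given for [S]; well-founded induction on the monomial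
    order leaves only the monomials of the footprint. *)
Lemma footprint_bound K (Z : {set grid A}) (S : seq 'X_{1..m}) :
    (forall i, #|` A i| <= K.+1)%N ->
    {in S, forall a, exists f, [/\ f != 0, mlead f = a & forall x, x \in Z -> f.@[grid_pt x] = 0]} ->
  (#|Z| <= #|[set p : pt K m in box (fun i => #|` A i|) | all (fun a => ~~ (a <= expo p)%MM) S]|)%N.
Proof.
move=> nK Sf; set D := finset _.
pose M : 'M[F]_(#|D|, #|Z|) := \matrix_k ev Z 'X_[expo (enum_val k)].
apply: (full_ev (M := M)) => f; apply: ev_sub => a _; elim/(ltmwf (n := m)): a => a IH.
have [aS|] := boolP (all (fun b => ~~ (b <= a)%MM) S); last first.
  rewrite -has_predC => /hasP[b /Sf[g [g0 <- gZ]] /= /negPn ba].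
  apply: ev_reduce g0 _ ba IH; apply/rowP => k; rewrite !mxE gZ //; exact: enum_valP.
have [an|/forallPn[i]] := boolP [forall i, a i < #|` A i|]%N; last first.
  rewrite -leqNgt => ia; apply: (@ev_reduce _ _ _ (root_prod i (A i))) IH.
  - exact: root_prod_neq0.
  - apply/rowP => k; rewrite !mxE root_prodE.
    by rewrite (bigD1_seq (grid_pt (enum_val k) i)) ?grid_ptP ?fset_uniq //= subrr mul0r.
  rewrite mlead_root_prod; apply/mnm_lepP => j; rewrite mulmnE mnm1E.
  by case: eqVneq => [<-|_]; rewrite ?mul1n.
have aE : expo (of_expo K a) = a by apply: of_expoK nK _ _; exact/forallP.
have aD : of_expo K a \in D.
  by rewrite inE aE aS andbT; apply/boxP => i; have := forallP an i; rewrite -{1}aE mnmE.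
have -> : ev Z 'X_[a] = row (enum_rank_in aD (of_expo K a)) M.
  by rewrite rowK enum_rankK_in // aE.
exact: row_sub.
Qed.

End Footprint.

(** * Leading monomials of a free family *)

Section LeadingMonomials.
Variables (F : fieldType) (m r : nat) (f : 'I_r -> {mpoly F[m]}).

(** As long as [k < r], some nonzero combination has coefficient zero at the [k]
    leading monomials found so far, so its own leading monomial is a new one. *)
Lemma free_leads k :
    (forall u : 'I_r -> F, \sum_i u i *: f i = 0 -> forall i, u i = 0) -> (k <= r)%N ->
  exists S : seq 'X_{1..m}, [/\ uniq S, size S = k &
    {in S, forall a, exists u : 'I_r -> F,
      let g := \sum_i u i *: f i in g != 0 /\ mlead g = a}].
Proof.
move=> f_free; elim: k => [|k IH] kr; first by exists [::].
have [S [Su Sk Sl]] := IH (ltnW kr).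
pose C : 'M[F]_(r, k) := \matrix_(i, j) (f i)@_(nth 0%MM S j).
have : kermx C != 0.
  rewrite kermx_eq0; apply: contraTN kr => /eqP Cr.
  by rewrite -leqNgt -Cr rank_leq_col.
case/rowV0Pn => v /sub_kermxP vC v0.
pose g := \sum_i v 0 i *: f i.
have g0 : g != 0.
  apply: contraNneq v0 => /f_free v_eq0; apply/eqP/rowP => i; by rewrite mxE v_eq0.
exists (mlead g :: S); split=> [|/=|a]; [rewrite /= Su andbT | by rewrite Sk | ].
  apply/negP => gS; have := mleadc_eq0 g; rewrite (negbTE g0) => /negP; apply.
  have ik : (index (mlead g) S < k)%N by rewrite -Sk index_mem.
  move/rowP/(_ (Ordinal ik)): vC; rewrite !mxE => e; apply/eqP; rewrite -[RHS]e.
  rewrite raddf_sum; apply: eq_bigr => i _.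
  by rewrite /= mcoeffZ mxE /= nth_index.
rewrite inE => /predU1P[->|/Sl//]; by exists (v 0).
Qed.

End LeadingMonomials.

(** * Polynomials attaining the bound *)

Section CornerPolynomials.
Variables (F : fieldType) (K m : nat) (A : 'I_m -> {fset F}).
Hypothesis nK : forall i, (#|` A i| <= K.+1)%N.
Implicit Types (a b : 'X_{1..m}) (p q : {mpoly F[m]}).

Lemma msupp_le_mul a b p q :
    {in msupp p, forall c, (c <= a)%MM} -> {in msupp q, forall c, (c <= b)%MM} ->
  {in msupp (p * q), forall c, (c <= a + b)%MM}.
Proof.
move=> pa qb c /msuppM_le /allpairsP[[c1 c2] /= [/pa c1a /qb c2b ->]].
apply/mnm_lepP => i; rewrite !mnmDE.
by apply: leq_add; [exact: (mnm_lepP c1a) | exact: (mnm_lepP c2b)].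
Qed.

Lemma msupp_root_prod i s : {in msupp (root_prod i s : {mpoly F[m]}), forall c, (c <= U_(i) *+ size s)%MM}.
Proof.
elim: s => [|x s IH] c.
  by rewrite /root_prod big_nil msupp1 inE => /eqP->; exact: lepm_refl.
rewrite /root_prod big_cons mulmS; apply: msupp_le_mul => // {}c.
move=> /msuppB_le; rewrite mem_cat msuppX inE msuppC => /orP[/eqP->|]; first exact: lepm_refl.
by case: ifP => // _; rewrite inE => /eqP->; apply/mnm_lepP => j; rewrite mnm0E.
Qed.

Definition corner_poly b : {mpoly F[m]} := \prod_i root_prod i (take (b i) (A i)).

Lemma msupp_corner b : (forall i, b i < #|` A i|)%N ->
  {in msupp (corner_poly b), forall c, (c <= b)%MM}.
Proof.
move=> bA c; rewrite [X in _ -> (c <= X)%MM]multinomUE_id /corner_poly; move: c.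
elim/big_rec2: _ => [c|i a q _ IH]; first by rewrite msupp1 inE => /eqP->; exact: lepm_refl.
by apply: msupp_le_mul IH => c /msupp_root_prod; rewrite size_takel // ltnW.
Qed.

Lemma corner_poly_Sle d b : b \in Fle (fun i => #|` A i|) d -> corner_poly b \in Sle_pred A d.
Proof.
rewrite mem_Fle => /andP[bd /forallP bA]; apply/Sle_predP => c /(msupp_corner bA) cb.
rewrite mem_Fle; apply/andP; split; last first.
  by apply/forallP => i; exact: leq_ltn_trans (mnm_lepP cb i) (bA i).
by apply: leq_trans bd; rewrite !mdegE leq_sum // => i _; exact: (mnm_lepP cb).
Qed.

Lemma corner_poly_neq0 b (x : grid A) :
  ((corner_poly b).@[grid_pt x] != 0) = [forall i, b i <= pt_of K x i]%N.
Proof.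
rewrite /corner_poly (big_morph _ (mevalM _) (meval1 _)); apply/prodf_neq0/forallP => h i.
  have := h i isT; rewrite root_prodE prodf_seq_neq0 leqNgt pt_ofE //.
  rewrite -in_take ?grid_ptP //; apply: contraL => xi; apply/allPn.
  by exists (grid_pt x i); rewrite //= subrr eqxx.
move=> _; rewrite root_prodE prodf_seq_neq0; apply/allP => c ci; apply/implyP => _.
rewrite subr_eq0; apply: contraTneq (h i) => e.
by rewrite -ltnNge pt_ofE // -in_take ?grid_ptP // e.
Qed.

End CornerPolynomials.

Theorem theorem4p6 (F : fieldType) (m : nat) (A : 'I_m -> {fset F}) (d r : nat)
  (A_neq0 : forall i : 'I_m, A i != fset0)
  (A_mono : forall i j : 'I_m, (i <= j)%N -> (#|` A i| <= #|` A j|)%N)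
  (d_ge1 : (1 <= d)%N)
  (d_lek : (d <= \sum_(i < m) (#|` A i| - 1))%N)
  (r_gt0 : (0 < r)%N)
  (r_le : (r <= \dim {: Sle A d})%N) :
  let Zcount (f : r.-tuple (Sle A d)) :=
    #|[set x : grid A | grid_pt x \in common_zeros (fun k => tnth f k : {mpoly F[m]})]| in
  let a := nth 0%MM (Fle_desc (fun i => #|` A i|) d) r.-1 in
  let v := (\sum_(i < m) a i * \prod_(j < m | (i < j)%N) #|` A j|)%N in
  (exists2 f : r.-tuple (Sle A d), free f & Zcount f = v) /\
  (forall f : r.-tuple (Sle A d), free f -> (Zcount f <= v)%N).
Proof.
move=> Zcount a v; pose n i := #|` A i|; pose K := \max_i n i.
have nK i : (n i <= K.+1)%N by apply: leqW; rewrite leq_bigmax.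
pose s := Fle_desc n d.
have ks : (r.-1 < size s)%N by rewrite size_desc -dim_Sle prednK.
have sF j : (j < r)%N -> nth 0%MM s j \in Fle n d.
  by move=> jr; apply: (nth_desc_Fle ks); rewrite -ltnS prednK.
have aF : a \in Fle n d by apply: (sF r.-1); rewrite prednK.
pose q : pt K m := of_expo K a.
have qE : expo q = a by apply: (Fle_expoP nK aF).
have qb : q \in box n by move: aF; rewrite -qE expo_Fle => /setIP[].
have vE : v = rank n q.
  by rewrite (rankE nK qb); apply: eq_bigr => i _; rewrite -qE mnmE.
split.
  pose f : r.-tuple (Sle A d) := [tuple MkSle (corner_poly_Sle (sF j (ltn_ord j))) | j < r].
  have fE j (x : grid A) : ((tnth f j : {mpoly F[m]}).@[grid_pt x] == 0) =
                ~~ [forall i, nth 0%MM s j i <= pt_of K x i]%N.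
    by rewrite tnth_mktuple -[LHS]negbK; congr (~~ _); exact: (corner_poly_neq0 nK).
  exists f.
    apply/freeP => u u0 j0; apply/eqP; apply: contraT => uj0.
    (* At the point indexed by the least exponent that occurs, only its own
       polynomial survives. *)
    case: (@arg_maxnP _ j0 (fun j => u j != 0) val uj0) => j uj jmax.
    have bF := sF j (ltn_ord j); have bE := Fle_expoP nK bF.
    have [x xE] : exists x : grid A, pt_of K x = of_expo K (nth 0%MM s j).
      by apply: pt_of_onto nK _ _; move: bF; rewrite -{1}bE expo_Fle => /setIP[].
    have le_x i : pt_of K x i = nth 0%MM s j i :> nat by rewrite xE -{2}bE mnmE.
    have : (\sum_k u k *: (tnth f k : {mpoly F[m]})).@[grid_pt x] = 0.
      rewrite -[RHS](meval0 (grid_pt x)); congr meval.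
      rewrite -[RHS](raddf0 (val : Sle A d -> _)) -u0 raddf_sum.
      by apply: eq_bigr => k _; rewrite -tnth_nth; exact/esym/GRing.valZ.
    rewrite raddf_sum (bigD1 j) //= big1 => [|k kj].
      rewrite addr0 mevalZ => /eqP; rewrite mulf_eq0 (negbTE uj) fE /=.
      by case/negP; apply/forallP => i; rewrite le_x.
    rewrite mevalZ; have [->|uk] := eqVneq (u k) 0; first by rewrite mul0r.
    apply/eqP; rewrite mulf_eq0 (negbTE uk) fE /=; apply/negP => /forallP le.
    have kltj : (k < j)%N by have := jmax k uk; rewrite /geq /= leq_eqVlt val_eqE (negbTE kj).
    have kE := Fle_expoP nK (sF k (ltn_ord k)).
    have /le_lex[/(congr1 (@expo K m))|] :
        forall i, (of_expo K (nth 0%MM s k) i <= of_expo K (nth 0%MM s j) i)%N.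
    - by move=> i; rewrite -xE; apply: leq_trans (le i); rewrite -[in X in (_ <= X)%N]kE mnmE.
    - have js : (j < size s)%N by apply: leq_trans (ltn_ord j) _; rewrite -[r]prednK.
      rewrite kE bE => /eqP; rewrite nth_uniq ?desc_uniq ?(ltn_trans kltj) //.
      by rewrite ltn_eqF.
    apply/negP; rewrite /lex kE bE; apply: (desc_nth_lex nK _ (ltnW kltj)).
    by apply: leq_trans (ltn_ord j) _; rewrite -[r]prednK.
  rewrite vE /Zcount /rank -(card_grid nK (fun p => lex p q)); apply: eq_card => x.
  rewrite !inE; apply/forallP/idP => [h|xq j].
    apply: contraT => /(desc_dominates nK ks (pt_of_box nK x))[j jk].
    have jr : (j < r)%N by rewrite -[r]prednK.
    by have := h (Ordinal jr); rewrite fE => /forallPn[i /negP ni] /(_ i).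
  rewrite fE; apply: contraT => /negPn/forallP le.
  have sj : expo (of_expo K (nth 0%MM s j)) = nth 0%MM s j.
    exact: (Fle_expoP nK (sF j (ltn_ord j))).
  have : ~~ lex (of_expo K (nth 0%MM s j)) q.
    by rewrite /lex sj qE; apply: (desc_nth_lex nK ks); rewrite -ltnS prednK.
  have /le_lex[->|jx] : forall i, (of_expo K (nth 0%MM s j) i <= pt_of K x i)%N.
  - by move=> i; apply: leq_trans (le i); rewrite -[in X in (_ <= X)%N]sj mnmE.
  - by rewrite xq.
  case/negP;   exact: lex_trans jx xq.
move=> f /freeP f_free; rewrite vE.
have [u f0|S [Su Sr Sl]] := free_leads (f := fun j => tnth f j : {mpoly F[m]}) _ (leqnn r).
  apply: f_free; apply: val_inj; rewrite raddf_sum raddf0 -[RHS]f0.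
  by apply: eq_bigr => j _; rewrite (tnth_nth 0); exact: GRing.valZ.
pose Z := [set x : grid A | grid_pt x \in common_zeros (fun k => tnth f k : {mpoly F[m]})].
have leadsE b : b \in S -> exists g : {mpoly F[m]},
    [/\ g != 0, mlead g = b, g \in Sle_pred A d & forall x, x \in Z -> g.@[grid_pt x] = 0].
  move=> /Sl[u /= [g0 gb]]; eexists; split; [exact: g0 | exact: gb | |].
    by apply: rpred_sum => j _; apply: rpredZ; exact: valP.
  move=> x; rewrite !inE => /forallP xZ; rewrite raddf_sum big1 // => j _.
  by rewrite /= mevalZ (eqP (xZ j)) mulr0.
pose D := [set p : pt K m in box n | all (fun b => ~~ (b <= expo p)%MM) S].
apply: leq_trans (footprint_bound (S := S) nK _) _ => [b /leadsE[g [g0 gb _ gZ]]|].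
  by exists g.
rewrite -/n -/D.
have DE p : (p \in D) = (p \in box n) && all (fun b => ~~ (b <= expo p)%MM) S by exact: in_set.
have Dd : down n D.
  split=> [|p p']; first by apply/subsetP => p; rewrite DE => /andP[].
  rewrite !DE => /andP[/boxP pb /allP pS] le; apply/andP; split.
    by apply/boxP => i; exact: leq_ltn_trans (le i) (pb i).
  apply/allP => b /pS; apply: contra => /mnm_lepP bp; apply/mnm_lepP => i.
  by apply: leq_trans (bp i) _; rewrite !mnmE.
rewrite leqNgt; apply/negP => qD.
pose B : {set pt K m} := box n :&: low d.
have lowD : (#|D :&: low d| + r <= #|B|)%N.
  pose T := [set p in B | expo p \in S].
  have TE p : (p \in T) = (p \in B) && (expo p \in S) by exact: in_set.
  have SF b : b \in S -> b \in Fle n d.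
    by move=> /leadsE[g [g0 <- /Sle_predP gS _]]; apply: gS; exact: mlead_supp.
  have <- : #|T| = r.
    rewrite -Sr -(size_map (of_expo K)).
    have Uu : uniq [seq of_expo K b | b <- S].
      rewrite (map_inj_in_uniq (f := of_expo K)) // => b b' /SF bF /SF b'F e.
      by rewrite -(Fle_expoP nK bF) e (Fle_expoP nK b'F).
    rewrite -(card_uniqP Uu); apply: eq_card => p; rewrite TE /B -expo_Fle.
    apply/andP/mapP => [[_ pS]|[b bS ->]]; first by exists (expo p); rewrite ?expoK.
    by rewrite (Fle_expoP nK (SF b bS)) SF.
  rewrite -cardsUI [X in (_ + X)%N]eq_card0 ?addn0 => [|p].
    apply: subset_leq_card; apply/subsetP => p /setUP[/setIP[pD pl]|]; last by rewrite TE => /andP[].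
    by rewrite in_setI pl andbT; exact: (subsetP Dd.1).
  rewrite in_setI in_setI DE TE; apply/negP => /andP[/andP[/andP[_ /allP pS] _] /andP[_ /pS]].
  by rewrite lepm_refl.
have := low_segP nK A_mono d Dd; rewrite leqNgt => /negP; apply.
have lowq : (#|B| <= #|(seg n (rank n q).+1 : {set pt K m}) :&: low d| + r.-1)%N.
  rewrite -(cardsID [set p | ~~ lex q p] B) leq_add //.
    apply: subset_leq_card; apply/subsetP => p; rewrite !in_setI [p \in finset _]in_set in_seg.
    by move=> /andP[/andP[pb ->] qp]; rewrite pb andbT ltnS leqNgt (rank_le_lex qb pb).
  apply: leq_trans (card_low_above nK ks); apply: subset_leq_card; apply/subsetP => p.
  by rewrite in_setD !in_set negbK andbC.
apply: leq_trans (subset_leq_card (setSI _ (seg_sub K n qD))).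
by rewrite -(ltn_add2r r.-1); apply: leq_trans lowq; rewrite -addnS prednK.
Qed.
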